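(* Let $\tau_0,\tau_1>0$, $n\ge1$, $\lambda_i>0$ with $\sum_{i=1}^n\lambda_i=1$, $a_i>0$, $m_i\in\mathbb R^d$, $\Sigma_i\in\mathbb S_{++}^d$, $\mu_i=\mathcal N(m_i,\Sigma_i)$, $i=1,\dots,n$, and let $\mathsf F$, $\mathsf Z$, $\theta$, $\bar a$ be as in the context. For every fixed $\nu\in\mathcal G_d^1$, the map $b\mapsto\mathsf F(b,\nu)$ is strictly convex on $(0,\infty)$ and has the unique minimizer $$b(\nu)=\mathsf Z(\nu)^{1/\theta}.$$ The profiled objective is $$\Phi(\nu):=\inf_{b>0}\mathsf F(b,\nu)=\tau_0\left(\bar a-\mathsf Z(\nu)^{1/\theta}\right).$$ Moreover, $$\operatorname*{argmin}_{b>0,\ \nu\in\mathcal G_d^1}\mathsf F(b,\nu)=\left\{\left(\mathsf Z(\nu)^{1/\theta},\nu\right):\nu\in\operatorname*{argmax}_{\mathcal G_d^1}\mathsf Z\right\}.$$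
   Context: $\mathbb S_{++}^d$ is the set of real symmetric positive-definite $d\times d$ matrices, and $\mathcal G_d^1=\{\mathcal N(m,\Sigma):m\in\mathbb R^d,\ \Sigma\in\mathbb S_{++}^d\}$ is the set of nondegenerate Gaussian probability measures. For finite nonnegative Borel measures, $\mathrm{KL}(\rho\mid\eta)=\int(r\log r-r+1)\,d\eta$ if $\rho\ll\eta$ with $r=d\rho/d\eta$, and $+\infty$ otherwise. For finite nonnegative Borel measures $\alpha,\beta$ on $\mathbb R^d$, $$\mathsf U_{\tau_0,\tau_1}(\alpha,\beta)=\inf_{\gamma}\Big\{\int\|x-y\|^2\,d\gamma+\tau_0\mathrm{KL}(\gamma_0\mid\alpha)+\tau_1\mathrm{KL}(\gamma_1\mid\beta)\Big\},$$ the infimum being over finite nonnegative Borel measures $\gamma$ on $\mathbb R^d\times\mathbb R^d$ with first and second marginals $\gamma_0,\gamma_1$. Put $s=\tau_0+\tau_1$, $\theta=\tau_0/s$. For $\mu,\nu\in\mathcal G_d^1$, $$\mathsf A(\mu,\nu)=\inf_{p,q\in\mathcal P(\mathbb R^d)}\{W_2^2(p,q)+\tau_0\mathrm{KL}(p\mid\mu)+\tau_1\mathrm{KL}(q\mid\nu)\},$$ where $W_2^2(p,q)\in[0,\infty]$ is the infimum of $\int|x-y|^2d\pi$ over couplings $\pi$ of $p,q$. Set $\mathsf F(b,\nu)=\sum_{i=1}^n\lambda_i\,\mathsf U_{\tau_0,\tau_1}(a_i\mu_i,b\nu)$ for $b>0$, $\nu\in\mathcal G_d^1$; $A_i(\nu)=\mathsf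 A(\mu_i,\nu)$; $\mathsf Z(\nu)=\sum_{i=1}^n\lambda_i a_i^\theta e^{-A_i(\nu)/s}$; $\bar a=\sum_{i=1}^n\lambda_i a_i$. *)

(* Defs.v *)
From HB Require Import structures.
From mathcomp Require Import all_boot all_order all_algebra.
From mathcomp Require Import all_classical all_reals all_analysis.

Set Implicit Arguments.
Unset Strict Implicit.
Unset Printing Implicit Defensive.

Import Order.TTheory GRing.Theory Num.Theory.
Import numFieldNormedType.Exports.

Local Open Scope classical_set_scope.
Local Open Scope ring_scope.
Local Open Scope ereal_scope.

(* Points of R^d are d-tuples; the product sigma-algebra that the library puts
   on tuples is the Borel sigma-algebra of R^d. *)
Notation Rd R d := (d.-tuple (measurableTypeR R)).

Definition dist2 (R : realType) (d : nat) (x y : Rd R d) : R :=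
  (\sum_(i < d) (tnth x i - tnth y i) ^+ 2)%R.

Section pushforward_sigma_additive.
Context d1 d2 (T1 : measurableType d1) (T2 : measurableType d2) (R : realType).

Lemma pushforward_semi_sigma_additive (mu : {measure set T1 -> \bar R})
    (f : T1 -> T2) :
  measurable_fun setT f -> semi_sigma_additive (pushforward mu f).
Proof.
move=> mf B mB tB mUB; rewrite /pushforward preimage_bigcup.
apply: measure_semi_sigma_additive.
- by move=> n; rewrite -[X in measurable X]setTI; exact: mf.
- apply/trivIsetP => /= i j _ _ ij; rewrite -preimage_setI.
  by move/trivIsetP : tB => /(_ _ _ _ _ ij) ->//; rewrite preimage_set0.
- by rewrite -preimage_bigcup -[X in measurable X]setTI; exact: mf.
Qed.

End pushforward_sigma_additive.

Section lebesgue_Rd.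
Context (R : realType).

Definition cons_Rd (d : nat) (p : measurableTypeR R * Rd R d) : Rd R d.+1 :=
  [tuple of p.1 :: p.2].

Lemma measurable_cons_Rd d : measurable_fun setT (@cons_Rd d).
Proof. exact: measurable_cons. Qed.

Definition lebesgue_cons (d : nat)
    (m : {sigma_finite_measure set (Rd R d) -> \bar R}) :
    set (Rd R d.+1) -> \bar R :=
  pushforward (@lebesgue_measure R \x m) (@cons_Rd d).

Section instances.
Context (d : nat) (m : {sigma_finite_measure set (Rd R d) -> \bar R}).

Let pf := lebesgue_cons m.

Let pf0 : pf set0 = 0.
Proof. by rewrite /pf /lebesgue_cons /pushforward preimage_set0 measure0. Qed.

Let pf_ge0 A : 0 <= pf A.
Proof. by rewrite /pf /lebesgue_cons /pushforward measure_ge0. Qed.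

Let pf_sigma_additive : semi_sigma_additive pf.
Proof.
by apply: pushforward_semi_sigma_additive; exact: measurable_cons_Rd.
Qed.

HB.instance Definition _ := isMeasure.Build _ _ _ (lebesgue_cons m)
  pf0 pf_ge0 pf_sigma_additive.

Let pf_sigma_finite : sigma_finite setT pf.
Proof.
have /sigma_finiteP[F [TF ndF mF]] := sigma_finiteT (@lebesgue_measure R).
have /sigma_finiteP[G [TG ndG mG]] := sigma_finiteT m.
pose h (x : Rd R d.+1) : measurableTypeR R * Rd R d :=
  (thead x, [tuple of behead x]).
have mh : measurable_fun setT h.
  by apply/measurable_fun_pairP; split;
    [exact: measurable_tnth | exact: measurable_behead].
exists (fun k => h @^-1` (F k `*` G k)).
  rewrite predeqE => x; split=> // _.
  have [k _ Fk] : (\bigcup_i F i) (h x).1 by rewrite -TF.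
  have [l _ Gl] : (\bigcup_i G i) (h x).2 by rewrite -TG.
  exists (maxn k l) => //; split.
    by move: Fk; exact/subsetPset/ndF/leq_maxl.
  by move: Gl; exact/subsetPset/ndG/leq_maxr.
move=> k; have [mFk Fky] := mF k; have [mGk Gky] := mG k; split.
  by rewrite -[X in measurable X]setTI; apply: mh => //; exact: measurableX.
rewrite /pf /lebesgue_cons /pushforward -comp_preimage.
rewrite (_ : h \o @cons_Rd d = id); last first.
  apply/funext => -[x t]; rewrite /h /cons_Rd /=; congr pair.
  exact: val_inj.
by rewrite preimage_id product_measure1E// lte_mul_pinfty// ge0_fin_numE.
Qed.

HB.instance Definition _ :=
  Measure_isSigmaFinite.Build _ _ _ (lebesgue_cons m) pf_sigma_finite.

End instances.

Fixpoint lebesgue_Rd (d : nat) : {sigma_finite_measure set (Rd R d) -> \bar R} :=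
  match d with
  | 0%N => \d_[tuple]
  | d'.+1 => lebesgue_cons (lebesgue_Rd d')
  end.

End lebesgue_Rd.

Definition spd (R : realType) (d : nat) (S : 'M[R]_d) : Prop :=
  S^T%R = S /\ forall v : 'cV[R]_d, v != 0%R -> (0 < (v^T *m S *m v) 0 0)%R.

Definition gaussian_pdf (R : realType) (d : nat) (m : Rd R d) (S : 'M[R]_d)
    (x : Rd R d) : R :=
  let v : 'cV[R]_d := (\col_i (tnth x i - tnth m i))%R in
  ((Num.sqrt ((pi *+ 2) ^+ d * \det S))^-1 *
     expR (- (v^T *m invmx S *m v) 0 0 / 2))%R.

Definition is_gaussian (R : realType) (d : nat) (m : Rd R d) (S : 'M[R]_d)
    (P : probability (Rd R d) R) : Prop :=
  forall B, measurable B ->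
    P B = \int[lebesgue_Rd R d]_(x in B) (gaussian_pdf m S x)%:E.

Definition nondegenerate_gaussian (R : realType) (d : nat) :
    set (probability (Rd R d) R) :=
  [set P | exists (m : Rd R d) (S : 'M[R]_d), spd S /\ is_gaussian m S P].

(* [ln 0 = 0], so that the convention 0 log 0 = 0 holds. *)
Definition KL (dT : measure_display) (T : measurableType dT) (R : realType)
    (rho eta : {finite_measure set T -> \bar R}) : \bar R :=
  if pselect (rho `<< eta) then
    let r x := fine (Radon_Nikodym (charge_of_finite_measure rho) eta x) in
    \int[eta]_x (r x * ln (r x) - r x + 1)%:E
  else +oo.

Section marginals.
Context d1 d2 (T1 : measurableType d1) (T2 : measurableType d2) (R : realType).

Definition marginal1 (g : {finite_measure set (T1 * T2)%type -> \bar R}) :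
  set T1 -> \bar R := pushforward g fst.
Definition marginal2 (g : {finite_measure set (T1 * T2)%type -> \bar R}) :
  set T2 -> \bar R := pushforward g snd.

Section instances.
Variable g : {finite_measure set (T1 * T2)%type -> \bar R}.

Let m1_0 : marginal1 g set0 = 0. Proof. exact: measure0. Qed.
Let m1_ge0 B : 0 <= marginal1 g B. Proof. exact: measure_ge0. Qed.
Let m1_sigma_additive : semi_sigma_additive (marginal1 g).
Proof.
by apply: pushforward_semi_sigma_additive; exact: measurable_fst.
Qed.

HB.instance Definition _ := isMeasure.Build _ _ _ (marginal1 g)
  m1_0 m1_ge0 m1_sigma_additive.

Let m2_0 : marginal2 g set0 = 0. Proof. exact: measure0. Qed.
Let m2_ge0 B : 0 <= marginal2 g B. Proof. exact: measure_ge0. Qed.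
Let m2_sigma_additive : semi_sigma_additive (marginal2 g).
Proof.
by apply: pushforward_semi_sigma_additive; exact: measurable_snd.
Qed.

HB.instance Definition _ := isMeasure.Build _ _ _ (marginal2 g)
  m2_0 m2_ge0 m2_sigma_additive.

Let fin1 : fin_num_fun (marginal1 g).
Proof.
move=> B mB; apply: fin_num_measure.
by rewrite -[X in measurable X]setTI; exact: measurable_fst.
Qed.

Let fin2 : fin_num_fun (marginal2 g).
Proof.
move=> B mB; apply: fin_num_measure.
by rewrite -[X in measurable X]setTI; exact: measurable_snd.
Qed.

HB.instance Definition _ := Measure_isFinite.Build _ _ _ (marginal1 g) fin1.
HB.instance Definition _ := Measure_isFinite.Build _ _ _ (marginal2 g) fin2.

End instances.
End marginals.

Section rescale.
Context (dT : measure_display) (T : measurableType dT) (R : realType).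

(* The measure b mu, for b >= 0; the absolute value makes it total in b. *)
Definition rescale (b : R) (mu : {finite_measure set T -> \bar R}) :
  set T -> \bar R := mscale (`|b|%:nng)%R mu.

Variables (b : R) (mu : {finite_measure set T -> \bar R}).

HB.instance Definition _ := Measure.on (rescale b mu).

Let fin : fin_num_fun (rescale b mu).
Proof. by move=> B mB; rewrite fin_numM// fin_num_measure. Qed.

HB.instance Definition _ := Measure_isFinite.Build _ _ _ (rescale b mu) fin.

End rescale.

Section transport.
Context (R : realType) (d : nat).
Implicit Types (p q mu nu : probability (Rd R d) R).

Definition transport_cost
    (g : {finite_measure set (Rd R d * Rd R d)%type -> \bar R}) : \bar R :=
  \int[g]_z (dist2 z.1 z.2)%:E.

Definition UOT (tau0 tau1 : R)
    (alpha beta : {finite_measure set (Rd R d) -> \bar R}) : \bar R :=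
  ereal_inf [set transport_cost g + tau0%:E * KL (marginal1 g) alpha
                                  + tau1%:E * KL (marginal2 g) beta
            | g in [set: {finite_measure set (Rd R d * Rd R d)%type -> \bar R}]].

Definition coupling p q : set (probability (Rd R d * Rd R d)%type R) :=
  [set g | forall B, measurable B ->
             marginal1 g B = p B /\ marginal2 g B = q B].

Definition W2sq p q : \bar R :=
  ereal_inf [set transport_cost g | g in coupling p q].

Definition Aopt (tau0 tau1 : R) mu nu : \bar R :=
  ereal_inf [set W2sq pq.1 pq.2 + tau0%:E * KL pq.1 mu + tau1%:E * KL pq.2 nu
            | pq in [set: (probability (Rd R d) R * probability (Rd R d) R)%type]].

Context (tau0 tau1 : R) (n : nat) (lambda a : 'I_n -> R)
  (mu : 'I_n -> probability (Rd R d) R).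

Definition Fobj (b : R) nu : \bar R :=
  \sum_(i < n) (lambda i)%:E * UOT tau0 tau1 (rescale (a i) (mu i)) (rescale b nu).

Definition Phi nu : \bar R :=
  ereal_inf [set Fobj b nu | b in [set b : R | (0 < b)%R]].

Definition theta : R := (tau0 / (tau0 + tau1))%R.

(* [Aopt] is valued in [0, +oo], so that [expeR] is applied to a value in
   [-oo, 0] (with exp(-oo) = 0) and [fine] acts on [0, 1]. *)
Definition Zmass nu : R :=
  (\sum_(i < n) lambda i * a i `^ theta *
     fine (expeR (- (Aopt tau0 tau1 (mu i) nu * ((tau0 + tau1)^-1)%:E))))%R.

Definition abar : R := (\sum_(i < n) lambda i * a i)%R.

End transport.

(* When D is an open interval, the strict inequality forces f < +oo on D; for a
   nonnegative f, such as [Fobj], f is then real-valued on D. *)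
Definition strictly_convex_on (R : realType) (D : set R) (f : R -> \bar R) :
    Prop :=
  forall x y t : R, D x -> D y -> x != y -> (0 < t < 1)%R ->
    f (t * x + (1 - t) * y)%R < t%:E * f x + (1 - t)%:E * f y.

Definition argmin_on (dO : Order.disp_t) (O : porderType dO) (T : Type)
    (D : set T) (f : T -> O) : set T :=
  [set x | D x /\ forall y, D y -> (f x <= f y)%O].

Definition argmax_on (dO : Order.disp_t) (O : porderType dO) (T : Type)
    (D : set T) (f : T -> O) : set T :=
  [set x | D x /\ forall y, D y -> (f y <= f x)%O].

(* Main.v *)
(* Writing a nonzero plan as M times a probability pi with marginals p, q, the
   homogeneity identity
     KL(M p | a mu) = M KL(p | mu) + M ln (M / a) - M + a
   splits the unbalanced cost into M times the balanced cost plus a function of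
   M alone.  Minimizing first over pi, then over M, gives
     U(a mu, b nu) = tau0 a + tau1 b - s a^theta b^(1 - theta) exp (- A / s),
   hence F(b, nu) = tau0 abar + tau1 b - s Z(nu) b^(1 - theta).  All claims then
   follow from the strict tangent inequality for concave powers, applied at
   the candidate point.  Z(nu) > 0 because A is finite: the normalized
   restriction of each measure to a large ball has bounded density and bounded
   support. *)

Require Import Defs.
From mathcomp Require Import all_boot all_order all_algebra.
From mathcomp Require Import all_classical all_reals all_analysis.
From mathcomp Require Import measurable_realfun ring lra.

Set Implicit Arguments.
Unset Strict Implicit.
Unset Printing Implicit Defensive.

Import Order.TTheory GRing.Theory Num.Theory.
Import numFieldNormedType.Exports.

Local Open Scope classical_set_scope.
Local Open Scope ring_scope.

(** * Relative entropy computed from an explicit density *)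

(* Nonnegative on all of R, because [ln r = 0] for [r <= 0]. *)
Definition entropy_fun {R : realType} (r : R) : R := r * ln r - r + 1.

(** For [r > 0], the bound [1 + u <= expR u] at [u = - ln r] gives [1 - ln r <= 1 / r], to be
    multiplied by [r]; for [r <= 0] the value is [1 - r]. *)
Lemma entropy_fun_ge0 {R : realType} (r : R) : 0 <= entropy_fun r.
Proof.
rewrite /entropy_fun; have [r0|r0] := leP r 0; first by rewrite ln0//; lra.
have := expR_ge1Dx (- ln r); rewrite expRN lnK// -(ler_pM2l r0) mulfV ?gt_eqF//.
lra.
Qed.

Lemma measurable_entropy_fun {R : realType} :
  measurable_fun setT (@entropy_fun R).
Proof.
apply: measurable_funD => //; apply: measurable_funB => //.
by apply: measurable_funM => //; exact: measurable_ln.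
Qed.

Section KL_density.
Context d (T : measurableType d) (R : realType).
Implicit Types rho eta : {finite_measure set T -> \bar R}.

(** An everywhere finite version of the Radon-Nikodym derivative is used, so that the density is
    real-valued at every point. *)
Lemma dominated_density rho eta : rho `<< eta ->
  exists f : T -> R, [/\ measurable_fun setT f, forall x, 0 <= f x &
    forall B, measurable B -> rho B = (\int[eta]_(x in B) (f x)%:E)%E].
Proof.
move=> re; pose h := Radon_Nikodym_SigmaFinite.f rho eta.
have hfin := Radon_Nikodym_SigmaFinite.f_fin_num re.
have hE x : ((fine (h x))%:E = h x)%E by rewrite fineK.
exists (fine \o h); split => [|x|B mB] /=.
- apply: measurableT_comp => //.
  exact: measurable_int (Radon_Nikodym_SigmaFinite.f_integrable re).
- by rewrite fine_ge0// Radon_Nikodym_SigmaFinite.f_ge0.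
- under eq_integral do rewrite hE.
  exact: Radon_Nikodym_SigmaFinite.f_integral.
Qed.

(** [KL] fixes one derivative. Any other density has the same integral over every measurable set,
    hence agrees with it almost everywhere, so explicit densities may be used. *)
Lemma KL_density rho eta (f : T -> R) :
  measurable_fun setT f -> (forall x, 0 <= f x) ->
  (forall B, measurable B -> rho B = (\int[eta]_(x in B) (f x)%:E)%E) ->
  KL rho eta = (\int[eta]_x (entropy_fun (f x))%:E)%E.
Proof.
move=> mf f0 fE.
have re : rho `<< eta.
  apply/null_content_dominatesP => B mB B0; rewrite fE//.
  by rewrite null_set_integral//; exact/measurable_EFinP/measurable_funTS.
rewrite /KL; case: pselect => // re'.
set h := Radon_Nikodym _ _.
have ih : eta.-integrable setT h by exact: Radon_Nikodym_integrable.
have mh : measurable_fun setT h by exact: measurable_int ih.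
have fh : ae_eq eta setT h (EFin \o f).
  apply: integral_ae_eq => //; first exact/measurable_EFinP.
  by move=> B _ mB; rewrite -Radon_Nikodym_integral// -fE.
apply: ae_eq_integral => //.
- apply/measurable_EFinP.
  apply: (measurableT_comp (@measurable_entropy_fun R)).
  exact: measurableT_comp.
- apply/measurable_EFinP.
  exact: (measurableT_comp (@measurable_entropy_fun R)).
- exact: (ae_eq_comp (fun y => (entropy_fun (fine y))%:E) fh).
Qed.

Lemma KL_ge0 rho eta : (0 <= KL rho eta)%E.
Proof.
rewrite /KL; case: pselect => // ?; apply: integral_ge0 => x _.
by rewrite lee_fin; exact: entropy_fun_ge0.
Qed.

End KL_density.

(** * Divergence under rescaling of the measures *)

Section rescale_lemmas.
Context d (T : measurableType d) (R : realType).
Implicit Types (rho mu : {finite_measure set T -> \bar R}) (a M : R).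

Lemma rescaleE a mu B : 0 <= a -> rescale a mu B = (a%:E * mu B)%E.
Proof. by move=> a0; rewrite /rescale /mscale/= ger0_norm. Qed.

Lemma ge0_integral_rescale a mu (f : T -> \bar R) D : measurable D -> 0 <= a ->
  measurable_fun D f -> (forall x, D x -> 0 <= f x)%E ->
  (\int[rescale a mu]_(x in D) f x = a%:E * \int[mu]_(x in D) f x)%E.
Proof.
move=> mD a0 mf f0; rewrite ge0_integral_mscale//=.
by rewrite ger0_norm.
Qed.

(** The density is 0, the integrand [entropy_fun 0 = 1], and the reference mass [a]. This prices the
    marginals of the zero plan. *)
Lemma KL_null a rho mu : 0 <= a -> mu setT = 1%E ->
  (forall B, measurable B -> rho B = 0%E) -> KL rho (rescale a mu) = a%:E.
Proof.
move=> a0 mu1 rho0.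
rewrite (@KL_density _ _ _ rho _ (cst 0))//; last first.
  by move=> B mB; rewrite rho0// integral0.
rewrite (eq_integral (cst 1%E)) => [|x _].
  by rewrite integral_cst// mul1e /= rescaleE// mu1 mule1.
by rewrite /entropy_fun /= mul0r subr0 add0r.
Qed.

(** If [p] has density [f] for [mu], then [rho] has density [c f] for [a mu], where [c = M / a], and
    [entropy_fun (c f) = c entropy_fun f + (c ln c) f + 1 - c]. Integrate this against [a mu], using
    that [f] has integral 1. *)
Lemma KL_rescale a M rho (p mu : {finite_measure set T -> \bar R}) :
  0 < a -> 0 < M ->
  p setT = 1%E -> mu setT = 1%E ->
  (forall B, measurable B -> rho B = (M%:E * p B)%E) ->
  KL rho (rescale a mu) =
    (M%:E * KL p mu + (M * ln (M / a) - M + a)%:E)%E.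
Proof.
move=> a0 M0 p1 mu1 rhoE.
have [pmu|npmu] := pselect (p `<< mu); last first.
  (* As [a] and [M] are positive, scaling changes no null set, so both divergences are infinite
     together. *)
  have nrho : ~ rho `<< rescale a mu.
    move=> /null_content_dominatesP h; apply: npmu.
    apply/null_content_dominatesP => B mB muB; have := h B mB.
    rewrite /= rescaleE ?ltW// muB mule0 => /(_ erefl)/eqP.
    by rewrite rhoE// mule_eq0 eqe gt_eqF//= => /eqP.
  rewrite /KL; case: pselect => // ?; case: pselect => // ?.
  by rewrite gt0_muley ?lte_fin.
have [f [mf f0 fE]] := dominated_density pmu.
have Ma0 : 0 < M / a by rewrite divr_gt0.
have mEf : measurable_fun setT (EFin \o f) by exact/measurable_EFinP.
rewrite (@KL_density _ _ _ rho _ (fun x => M / a * f x)).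
- rewrite (@KL_density _ _ _ p _ f)// ge0_integral_rescale//; last 3 first.
  + exact: ltW.
  + apply/measurable_EFinP/(measurableT_comp (@measurable_entropy_fun R)).
    exact: measurable_funM.
  + by move=> x _; rewrite lee_fin entropy_fun_ge0.
  have iphi x : ((entropy_fun (M / a * f x))%:E =
     (M / a)%:E * (entropy_fun (f x))%:E +
       ((M / a * ln (M / a)) * f x + (1 - M / a))%:E)%E.
    rewrite -EFinM -EFinD /entropy_fun; congr EFin.
    (* [lnM] needs positive factors; where [f] vanishes both sides equal 1. *)
    have := f0 x; rewrite le_eqVlt => /predU1P[<-|fx0]; first by ring.
    by rewrite lnM//; ring.
  have if1 : (\int[mu]_x (f x)%:E = 1)%E by rewrite -fE.
  have affine_int (u v : R) : 0 <= u -> 0 <= v ->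
      (\int[mu]_x (u * f x + v)%:E = (u + v)%:E)%E.
    move=> u0 v0; under eq_integral do rewrite EFinD EFinM.
    rewrite ge0_integralD//; last 2 first.
    + by move=> x _; rewrite mule_ge0// lee_fin.
    + exact: emeasurable_funM.
    rewrite integral_cst//= mu1 mule1 ge0_integralZl//; last first.
      by move=> x _; rewrite lee_fin.
    by rewrite if1 mule1.
  (* Only nonnegative integrands may be added when KL is infinite, so the affine
     correction is made nonnegative by adding [K * (f + 1)] to both sides. *)
  pose c := M / a; pose K := `|c * ln c| + `|1 - c|.
  have cK : 0 <= c * ln c + K.
    by have := ler_norm (- (c * ln c)); have := normr_ge0 (1 - c);
      rewrite normrN /K; lra.
  have cK' : 0 <= 1 - c + K.
    by have := ler_norm (- (1 - c)); have := normr_ge0 (c * ln c);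
      rewrite normrN /K; lra.
  have K0 : 0 <= K by rewrite addr_ge0.
  have mphi : measurable_fun setT (fun x => (entropy_fun (f x))%:E).
    by apply/measurable_EFinP/(measurableT_comp (@measurable_entropy_fun R)).
  have key : (\int[mu]_x (entropy_fun (c * f x))%:E + (K + K)%:E =
      c%:E * \int[mu]_x (entropy_fun (f x))%:E +
      (c * ln c + K + (1 - c + K))%:E)%E.
    rewrite -affine_int// -[X in (_ = _ + X)%E]affine_int//.
    rewrite -ge0_integralZl//; last 2 first.
    + by move=> x _; rewrite lee_fin entropy_fun_ge0.
    + by rewrite lee_fin ltW.
    rewrite -ge0_integralD//; last 4 first.
    + by move=> x _; rewrite lee_fin entropy_fun_ge0.
    + apply/measurable_EFinP/(measurableT_comp (@measurable_entropy_fun R)).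
      exact: measurable_funM.
    + by move=> x _; rewrite lee_fin addr_ge0// mulr_ge0.
    + by apply/measurable_EFinP/measurable_funD => //; exact: measurable_funM.
    rewrite -ge0_integralD//; last 4 first.
    + by move=> x _; rewrite mule_ge0// lee_fin ?entropy_fun_ge0// ltW.
    + exact: emeasurable_funM.
    + by move=> x _; rewrite lee_fin addr_ge0// mulr_ge0.
    + by apply/measurable_EFinP/measurable_funD => //; exact: measurable_funM.
    apply: eq_integral => x _; rewrite iphi -!EFinM -!EFinD; congr EFin.
    by rewrite -/c; ring.
  (* The added constant [K + K] is finite, so it cancels even when the integral is infinite. *)
  have {key} -> : (\int[mu]_x (entropy_fun (M / a * f x))%:E =
      c%:E * \int[mu]_x (entropy_fun (f x))%:E + (c * ln c + (1 - c))%:E)%E.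
    rewrite -[LHS](@addeK _ (K + K)%:E)// key -addeA -EFinB.
    by congr (_ + _%:E)%E; ring.
  rewrite muleDr ?fin_num_adde_defl// muleA -!EFinM.
  have aM : a * c = M by rewrite /c mulrCA mulfV ?gt_eqF// mulr1.
  rewrite aM -/c; congr (_ + _%:E)%E.
  by rewrite mulrDr mulrA aM mulrBr mulr1 aM; ring.
- exact: measurable_funM.
- by move=> x; rewrite mulr_ge0// ltW.
- move=> B mB; rewrite rhoE// ge0_integral_rescale//; last 3 first.
  + exact: ltW.
  + by apply/measurable_EFinP/measurable_funTS/measurable_funM.
  + by move=> x _; rewrite lee_fin mulr_ge0// ltW.
  under eq_integral do rewrite EFinM.
  rewrite ge0_integralZl//; last 3 first.
  + exact: measurable_funTS.
  + by move=> x _; rewrite lee_fin.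
  + by rewrite lee_fin ltW.
  by rewrite -fE// muleA -EFinM mulrCA mulfV ?gt_eqF// mulr1.
Qed.

End rescale_lemmas.

(** * Normalization, transport cost and finiteness of [Aopt] *)

Lemma normalized_measure d (T : measurableType d) (R : realType)
    (g : {finite_measure set T -> \bar R}) (M : R) :
  0 < M -> g setT = M%:E ->
  exists P : probability T R, forall B, g B = (M%:E * P B)%E.
Proof.
(* [dirac point] is the default for mass zero or infinite, both excluded here. *)
move=> M0 gM; exists (mnormalize g (dirac point)) => B /=.
rewrite /mnormalize /= gM eqe gt_eqF//= muleCA -EFinM divff ?gt_eqF//.
by rewrite mule1.
Qed.

Section transport.
Context (R : realType) (d : nat).
Implicit Types (g : {finite_measure set (Rd R d * Rd R d)%type -> \bar R}).
Implicit Types (p q mu nu : probability (Rd R d) R).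

Lemma dist2_ge0 (x y : Rd R d) : 0 <= dist2 x y.
Proof. by apply: sumr_ge0 => i _; exact: sqr_ge0. Qed.

(** In each coordinate the right side minus the left is the square of [a + b - 2 c]. *)
Lemma dist2_le (x y z : Rd R d) : dist2 x y <= 2 * (dist2 x z + dist2 y z).
Proof.
rewrite /dist2 -big_split mulr_sumr; apply: ler_sum => i _ /=.
set a := tnth x i; set b := tnth y i; set c := tnth z i.
by have := sqr_ge0 (a + b - 2 * c); lra.
Qed.

Lemma measurable_dist2 :
  measurable_fun setT (fun z : Rd R d * Rd R d => dist2 z.1 z.2).
Proof.
apply: measurable_sum => i; apply: measurable_funX.
apply: measurable_funB.
- exact: (measurableT_comp (measurable_tnth i) measurable_fst).
- exact: (measurableT_comp (measurable_tnth i) measurable_snd).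
Qed.

Lemma measurable_dist2r (y : Rd R d) :
  measurable_fun setT (fun x : Rd R d => dist2 x y).
Proof.
apply: measurable_sum => i; apply: measurable_funX.
by apply: measurable_funB => //; exact: measurable_tnth.
Qed.

Lemma measurable_dist2_ball (z : Rd R d) (r : R) :
  measurable [set x | dist2 x z <= r].
Proof.
rewrite -[X in measurable X]setTI.
rewrite -[X in _ `&` X]/((fun x => dist2 x z) @^-1` [set u | u <= r]).
apply: measurable_dist2r => //.
exact: (@measurable_itv R `]-oo, r]).
Qed.

Lemma transport_cost_ge0 g : (0 <= transport_cost g)%E.
Proof. by apply: integral_ge0 => z _; rewrite lee_fin dist2_ge0. Qed.

Lemma transport_cost_scale g g' (M : R) : 0 <= M ->
  (forall B, measurable B -> g B = (M%:E * g' B)%E) ->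
  transport_cost g = (M%:E * transport_cost g')%E.
Proof.
move=> M0 gE; rewrite /transport_cost.
rewrite (@eq_measure_integral _ _ _ _ (rescale M g')); last first.
  by move=> B mB _ /=; rewrite gE// rescaleE.
rewrite ge0_integral_rescale//.
- by apply/measurable_EFinP; exact: measurable_dist2.
- by move=> x _; rewrite lee_fin dist2_ge0.
Qed.

Lemma W2sq_ge0 p q : (0 <= W2sq p q)%E.
Proof. by apply: le_ereal_inf_tmp => _ [g _ <-]; exact: transport_cost_ge0. Qed.

(** [p] is [mu] conditioned on a ball of positive mass; its density [M^-1 * \1_(E k)] is bounded,
    hence so is the entropy integrand. *)
Lemma bounded_support_finite_KL mu (z : Rd R d) :
  exists p, exists k : R,
    p [set x | dist2 x z <= k] = 1%E /\ (KL p mu < +oo)%E.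
Proof.
pose E k := [set x : Rd R d | dist2 x z <= k%:R].
have mE k : measurable (E k) by exact: measurable_dist2_ball.
have [k muEk] : exists k, mu (E k) != 0%E.
  (* If all balls were null, so would be their countable union, the whole space. *)
  apply: contrapT => /forallNP h.
  have : mu.-negligible (\bigcup_k E k).
    apply: negligible_bigcup => k; exists (E k); split => //.
    by have := h k => /negP; rewrite negbK => /eqP.
  rewrite (_ : \bigcup_k E k = setT); last first.
    apply/seteqP; split => // x _; exists (Num.bound (dist2 x z)) => //.
    by rewrite /E/= ltW// archi_boundP// dist2_ge0.
  move=> /negligibleP => /(_ measurableT) /=; rewrite probability_setT.
  by move/eqP; rewrite onee_eq0.
have muEfin : mu (E k) \is a fin_num by exact: fin_num_measure.
pose M := fine (mu (E k)).
have ME : mu (E k) = M%:E by rewrite fineK.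
have M0 : 0 < M by rewrite -lte_fin -ME lt0e muEk measure_ge0.
have [|p pE] := @normalized_measure _ _ _ (mrestr mu (mE k)) M M0.
  by rewrite /= /mrestr setTI.
have pE' B : p B = (M^-1%:E * mu (B `&` E k))%E.
  have /= := pE B; rewrite /mrestr => ->.
  by rewrite muleA -EFinM mulVf ?gt_eqF// mul1e.
exists p, k%:R; split.
  by rewrite pE' setIid ME -EFinM mulVf ?gt_eqF.
pose f x : R := M^-1 * \1_(E k) x.
have mf : measurable_fun setT f.
  by apply: measurable_funM => //; exact: measurable_indic.
rewrite (@KL_density _ _ _ _ _ f)//; last 2 first.
- by move=> x; rewrite mulr_ge0// invr_ge0 ltW.
- move=> B mB /=; rewrite pE' /f; under eq_integral do rewrite EFinM.
  rewrite ge0_integralZl//.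
  + by rewrite integral_indic// setIC.
  + apply: measurable_funTS; exact/measurable_EFinP/measurable_indic.
  + by rewrite lee_fin invr_ge0 ltW.
(* The integrand is [entropy_fun M^-1] on the ball and 1 off it; the sum bounds both. *)
apply: (@le_lt_trans _ _ (\int[mu]_x (cst (1 + entropy_fun M^-1)%:E x))%E).
  apply: ge0_le_integral => //.
  - by move=> x _; rewrite lee_fin entropy_fun_ge0.
  - by apply/measurable_EFinP/(measurableT_comp (@measurable_entropy_fun R)).
  - move=> x _; rewrite lee_fin /f indicE; case: (x \in E k).
      by rewrite mulr1 lerDr.
    by rewrite mulr0 {1}/entropy_fun mul0r subr0 add0r lerDl entropy_fun_ge0.
by rewrite integral_cst//= probability_setT mule1 ltry.
Qed.

(** The product measure is a coupling, and under it the cost is almost everywhere bounded by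
    [dist2_le]. *)
Lemma W2sq_bounded_support p q (z : Rd R d) (k l : R) :
  p [set x | dist2 x z <= k] = 1%E -> q [set x | dist2 x z <= l] = 1%E ->
  (W2sq p q < +oo)%E.
Proof.
move=> pk ql.
have mE := measurable_dist2_ball z.
pose pi : probability (Rd R d * Rd R d)%type R := (p \x q)%E.
have piE A B : measurable A -> measurable B -> pi (A `*` B) = (p A * q B)%E.
  exact: product_measure1E.
apply: (@le_lt_trans _ _ (transport_cost pi)).
  apply: ereal_inf_lbound; exists pi => // B mB; split.
  - rewrite /marginal1 /pushforward.
    rewrite (_ : fst @^-1` B = B `*` setT); last first.
      by apply/seteqP; split => [[x y]|[x y] []].
    by rewrite /= piE// probability_setT mule1.
  - rewrite /marginal2 /pushforward.
    rewrite (_ : snd @^-1` B = setT `*` B); last first.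
      by apply/seteqP; split => [[x y]|[x y] []].
    by rewrite /= piE// probability_setT mul1e.
apply: (@le_lt_trans _ _ (\int[pi]_x (cst (2 * (`|k| + `|l|))%:E x))%E).
  apply: ae_ge0_le_integral => //.
  - by move=> x _; rewrite lee_fin dist2_ge0.
  - by apply/measurable_EFinP; exact: measurable_dist2.
  - by move=> x _; rewrite lee_fin mulr_ge0// addr_ge0.
  (* The bound is claimed only on this product of balls, whose complement is null. *)
  set D := [set x | dist2 x z <= k] `*` [set x | dist2 x z <= l].
  exists (~` D); split.
  - by apply: measurableC; exact: measurableX.
  - rewrite /= (probability_setC pi); last exact: measurableX.
    rewrite /D piE// pk ql mule1.
    exact: subee.
  - move=> [x y] /=; apply: contra_not => -[/= xk yl] _.
    rewrite lee_fin (le_trans (dist2_le x y z))// ler_pM2l//.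
    by rewrite lerD// (le_trans _ (ler_norm _)).
by rewrite integral_cst//= probability_setT mule1 ltry.
Qed.

Section objective.
Variables (tau0 tau1 : R).
Hypotheses (htau0 : 0 < tau0) (htau1 : 0 < tau1).

Lemma Aopt_ge0 mu nu : (0 <= Aopt tau0 tau1 mu nu)%E.
Proof.
apply: le_ereal_inf_tmp => _ [[p q] _ <-] /=.
by rewrite !adde_ge0 ?W2sq_ge0// mule_ge0 ?KL_ge0// lee_fin ltW.
Qed.

Lemma Aopt_fin_num mu nu : Aopt tau0 tau1 mu nu \is a fin_num.
Proof.
rewrite ge0_fin_numE ?Aopt_ge0//.
pose z : Rd R d := [tuple of nseq d 0].
have [p [k [pk Kp]]] := bounded_support_finite_KL mu z.
have [q [l [ql Kq]]] := bounded_support_finite_KL nu z.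
have := W2sq_bounded_support pk ql => Wpq.
apply: (@le_lt_trans _ _ (W2sq p q + tau0%:E * KL p mu + tau1%:E * KL q nu)%E).
  by apply: ereal_inf_lbound; exists (p, q).
rewrite !lte_add_pinfty// lte_mul_pinfty// ?lee_fin; exact: ltW.
Qed.

End objective.
End transport.

(** * Minimization over the total mass of a plan *)

Section optimal_mass.
Context {R : realType}.
Variables (tau0 tau1 : R).
Hypotheses (htau0 : 0 < tau0) (htau1 : 0 < tau1).
Local Notation s := (tau0 + tau1).
Local Notation th := (theta tau0 tau1).

(* The minimizer over M of the cost in [mass_costE]. *)
Definition optimal_mass (a b alpha : R) : R :=
  a `^ th * b `^ (1 - th) * expR (- (alpha / s)).

Lemma optimal_mass_gt0 a b alpha : 0 < a -> 0 < b -> 0 < optimal_mass a b alpha.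
Proof. by move=> a0 b0; rewrite !mulr_gt0 ?powR_gt0 ?expR_gt0. Qed.

(** With [N] the optimal mass, [s ln N = tau0 ln a + tau1 ln b - alpha], so the terms in [M]
    collapse to [s (M ln (M / N) - M)]. The last term is nonnegative and vanishes at [M = N], which
    settles the minimization without calculus. *)
Lemma mass_costE a b alpha M : 0 < a -> 0 < b -> 0 < M ->
  M * alpha + (tau0 * (M * ln (M / a) - M + a) +
               tau1 * (M * ln (M / b) - M + b)) =
  tau0 * a + tau1 * b - s * optimal_mass a b alpha +
    s * (optimal_mass a b alpha *
         entropy_fun (M / optimal_mass a b alpha)).
Proof.
move=> a0 b0 M0; have N0 := optimal_mass_gt0 alpha a0 b0.
set N := optimal_mass a b alpha in N0 *.
have s0 : s != 0 by rewrite gt_eqF// addr_gt0.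
have lnN : ln N = th * ln a + (1 - th) * ln b - alpha / s.
  rewrite /N /optimal_mass !lnM ?posrE ?mulr_gt0 ?powR_gt0 ?expR_gt0//.
  by rewrite !ln_powR expRK.
rewrite /entropy_fun !ln_div ?posrE// lnN /theta.
by field; rewrite s0 gt_eqF.
Qed.

End optimal_mass.

(** * Closed form of the unbalanced cost *)

Section UOT_formula.
Context (R : realType) (d : nat).
Implicit Types (g : {finite_measure set (Rd R d * Rd R d)%type -> \bar R}).
Implicit Types (p q mu nu : probability (Rd R d) R).
Implicit Types (pi : probability (Rd R d * Rd R d)%type R).
Variables (tau0 tau1 : R).
Hypotheses (htau0 : 0 < tau0) (htau1 : 0 < tau1).
Local Notation s := (tau0 + tau1).

(** The marginals are typed only as finite measures; normalizing with mass 1 repackages them as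
    probabilities. *)
Lemma coupling_marginals pi : exists p q, coupling p q pi.
Proof.
have m1 : marginal1 pi setT = 1%:E by exact: (probability_setT pi).
have m2 : marginal2 pi setT = 1%:E by exact: (probability_setT pi).
have [p pE] := normalized_measure ltr01 m1.
have [q qE] := normalized_measure ltr01 m2.
exists p, q => B mB; split.
- by have /= := pE B; rewrite mul1e.
- by have /= := qE B; rewrite mul1e.
Qed.

Definition UOT_cost g (alpha beta : {finite_measure set (Rd R d) -> \bar R}) :=
  (transport_cost g + tau0%:E * KL (marginal1 g) alpha
                    + tau1%:E * KL (marginal2 g) beta)%E.

(** The objective of [Aopt] for a single plan, before the infimum over couplings hidden in
    [W2sq]. *)
Definition A_cost pi p q mu nu :=
  (transport_cost pi + tau0%:E * KL p mu + tau1%:E * KL q nu)%E.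

Lemma A_cost_ge0 pi p q mu nu : (0 <= A_cost pi p q mu nu)%E.
Proof.
have h (r : R) x : 0 < r -> (0 <= x -> 0 <= r%:E * x)%E.
  by move=> r0 x0; rewrite mule_ge0// lee_fin ltW.
apply: adde_ge0; last by apply: h => //; exact: KL_ge0.
apply: adde_ge0; first exact: transport_cost_ge0.
by apply: h => //; exact: KL_ge0.
Qed.

(** Transport is linear in the plan, and [KL_rescale] treats each marginal. Distributing [M] over
    possibly infinite terms is sound because they are nonnegative. *)
Lemma UOT_cost_scale g pi p q mu nu (a b M : R) :
  0 < a -> 0 < b -> 0 < M -> coupling p q pi ->
  (forall B, measurable B -> g B = (M%:E * pi B)%E) ->
  UOT_cost g (rescale a mu) (rescale b nu) =
  (M%:E * A_cost pi p q mu nu +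
   (tau0 * (M * ln (M / a) - M + a) + tau1 * (M * ln (M / b) - M + b))%:E)%E.
Proof.
move=> a0 b0 M0 cpl gE; rewrite /UOT_cost (transport_cost_scale (ltW M0) gE).
have m1 B : measurable B -> marginal1 g B = (M%:E * p B)%E.
  move=> mB; have [<- _] := cpl B mB; apply: gE.
  by rewrite -[X in measurable X]setTI; exact: measurable_fst.
have m2 B : measurable B -> marginal2 g B = (M%:E * q B)%E.
  move=> mB; have [_ <-] := cpl B mB; apply: gE.
  by rewrite -[X in measurable X]setTI; exact: measurable_snd.
rewrite (@KL_rescale _ _ _ a M _ p)//; [|exact: probability_setT..].
rewrite (@KL_rescale _ _ _ b M _ q)//; [|exact: probability_setT..].
have tau0KL := mule_ge0 (ltW htau0 : (0 <= tau0%:E)%E) (KL_ge0 p mu).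
have tau1KL := mule_ge0 (ltW htau1 : (0 <= tau1%:E)%E) (KL_ge0 q nu).
have cost0 := transport_cost_ge0 pi.
have -> : (M%:E * A_cost pi p q mu nu = M%:E * transport_cost pi +
    M%:E * (tau0%:E * KL p mu) + M%:E * (tau1%:E * KL q nu))%E.
  rewrite /A_cost (ge0_muleDr _ (adde_ge0 cost0 tau0KL) tau1KL).
  by rewrite (ge0_muleDr _ cost0 tau0KL).
have scaleE (t r : R) x :
    (t%:E * (M%:E * x + r%:E) = M%:E * (t%:E * x) + (t * r)%:E)%E.
  by rewrite muleDr ?fin_num_adde_defl// muleCA EFinM.
by rewrite !scaleE EFinD !addeA; congr (_ + _)%E; rewrite addeAC.
Qed.

(** Merges the two nested infima: a finite divergence term can be subtracted before taking the
    infimum over couplings, and an infinite one makes the bound trivial since [W2sq] is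
    nonnegative. *)
Lemma Aopt_lb mu nu (x : \bar R) :
  (forall pi p q, coupling p q pi -> x <= A_cost pi p q mu nu)%E ->
  (x <= Aopt tau0 tau1 mu nu)%E.
Proof.
move=> xlb; apply: le_ereal_inf_tmp => _ [[p q] _ <-] /=.
have K0 : (0 <= tau0%:E * KL p mu + tau1%:E * KL q nu)%E.
  by rewrite adde_ge0// mule_ge0 ?KL_ge0// lee_fin ltW.
rewrite -addeA; move: K0.
have {xlb} : forall pi, coupling p q pi ->
  (x <= transport_cost pi + (tau0%:E * KL p mu + tau1%:E * KL q nu))%E.
  by move=> pi /xlb; rewrite /A_cost addeA.
case: (tau0%:E * KL p mu + tau1%:E * KL q nu)%E => [k||//] xlb k0; last first.
  by rewrite addey ?leey// gt_eqF// (lt_le_trans _ (W2sq_ge0 p q)).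
rewrite -leeBlDr//; apply: le_ereal_inf_tmp => _ [pi cpl <-].
by rewrite leeBlDr// xlb.
Qed.

(** Upper bound: test with [N] times a coupling. Lower bound: factor a nonzero plan as its mass
    times a probability and apply [mass_costE]. *)
Lemma UOT_eq mu nu (a b : R) : 0 < a -> 0 < b ->
  UOT tau0 tau1 (rescale a mu) (rescale b nu) =
  (tau0 * a + tau1 * b -
   s * optimal_mass tau0 tau1 a b (fine (Aopt tau0 tau1 mu nu)))%:E.
Proof.
move=> a0 b0; have := Aopt_fin_num htau0 htau1 mu nu.
set alpha := fine _ => /fineK alphaE.
set N := optimal_mass tau0 tau1 a b alpha.
have N0 : 0 < N by exact: optimal_mass_gt0.
have costE M := @mass_costE _ _ _ htau0 htau1 a b alpha M a0 b0.
have s0 : 0 < s by rewrite addr_gt0.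
apply/eqP; rewrite eq_le; apply/andP; split.
(* At [M = N] the entropy term vanishes, so the target value is [N * alpha + c]. *)
- have := costE N N0; rewrite divff ?gt_eqF// {1}/entropy_fun ln1.
  rewrite !mulr0 sub0r addNr !mulr0 addr0.
  set c := (X in _ + X = _) => <-.
  have ub pi p q : coupling p q pi ->
      (UOT tau0 tau1 (rescale a mu) (rescale b nu) <=
       N%:E * A_cost pi p q mu nu + c%:E)%E.
    move=> cpl; rewrite -(@UOT_cost_scale (rescale N pi))//; last first.
      by move=> B mB /=; rewrite rescaleE// ltW.
    by apply: ereal_inf_lbound; exists (rescale N pi).
  have lb x : (forall pi p q, coupling p q pi ->
      x <= A_cost pi p q mu nu)%E -> (x <= alpha%:E)%E.
    by move=> /Aopt_lb; rewrite alphaE.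
  (* Solving for the plan cost needs a real left side; the value [+oo] would make every [A_cost]
     infinite, hence [alpha] too. *)
  case: (UOT _ _ _ _) ub => [u||] ub.
  + rewrite lee_fin -lerBlDr mulrC -ler_pdivrMr// -lee_fin.
    apply: lb => pi p q /ub.
    rewrite -leeBlDr// -EFinB -lee_pdivrMl//.
    by rewrite EFinM muleC.
  + suff : (+oo <= alpha%:E)%E by [].
    apply: lb => pi p q /ub; have := A_cost_ge0 pi p q mu nu.
    by case: (A_cost _ _ _ _ _).
  + exact: leNye.
- apply: le_ereal_inf_tmp => _ [g _ <-]; rewrite -/(UOT_cost g _ _).
  have gfin : g setT \is a fin_num by exact: fin_num_measure.
  (* The zero plan cannot be normalized; it costs at least [tau0 * a + tau1 * b], which exceeds the
     claimed value by [s * N]. *)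
  have [g0|g0] := eqVneq (g setT) 0%E.
    have gB B : measurable B -> g B = 0%E.
      move=> mB; apply/eqP; rewrite eq_le measure_ge0 andbT -g0.
      by rewrite le_measure// inE.
    have m1 B : measurable B -> marginal1 g B = 0%E.
      move=> mB; apply: gB.
      by rewrite -[X in measurable X]setTI; exact: measurable_fst.
    have m2 B : measurable B -> marginal2 g B = 0%E.
      move=> mB; apply: gB.
      by rewrite -[X in measurable X]setTI; exact: measurable_snd.
    rewrite /UOT_cost (KL_null (ltW a0) (probability_setT mu) m1).
    rewrite (KL_null (ltW b0) (probability_setT nu) m2).
    rewrite -!EFinM -addeA -EFinD.
    apply: (@le_trans _ _ (tau0 * a + tau1 * b)%:E).
      by rewrite lee_fin gerBl mulr_ge0// ltW.
    by rewrite leeDr// transport_cost_ge0.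
  have gM : g setT = (fine (g setT))%:E by rewrite fineK.
  set M := fine (g setT) in gM.
  have M0 : 0 < M by rewrite -lte_fin -gM lt0e g0 measure_ge0.
  have [pi piE] := normalized_measure M0 gM.
  have [p [q cpl]] := coupling_marginals pi.
  rewrite (@UOT_cost_scale g pi p q mu nu a b M)//.
  apply: (@le_trans _ _ (M%:E * alpha%:E +
    (tau0 * (M * ln (M / a) - M + a) + tau1 * (M * ln (M / b) - M + b))%:E)%E).
    rewrite -EFinM -EFinD lee_fin costE// lerDl.
    by rewrite mulr_ge0 ?(ltW s0)// mulr_ge0 ?(ltW N0)// entropy_fun_ge0.
  apply: leeD2r; rewrite lee_pmul2l// alphaE.
  apply: (@le_trans _ _ (W2sq p q + tau0%:E * KL p mu + tau1%:E * KL q nu)%E).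
    by apply: ereal_inf_lbound; exists (p, q).
  by do 2 apply: leeD2r; apply: ereal_inf_lbound; exists pi.
Qed.

End UOT_formula.

(** * The objective as a function of the scalar [b] *)

Section scalar_profile.
Context {R : realType}.

(** Strict Bernoulli inequality; its strictness yields both strict convexity and uniqueness of the
    minimizer. *)
Lemma powR_lt_tangent (x r : R) : 0 < x -> x != 1 -> 0 < r < 1 ->
  x `^ r < 1 + r * (x - 1).
Proof.
move=> x0 x1 /andP[r0 r1]; set m := 1 + r * (x - 1).
have m0 : 0 < m by rewrite /m; nra.
have rx0 : 0 < r * x by exact: mulr_gt0.
have hx : x / m = expR (ln x - ln m) by rewrite expRD expRN !lnK.
have h1 : m^-1 = expR (- ln m) by rewrite expRN lnK.
(* Averaging [1 + u <= expR u] at u = ln (x / m) and u = ln (1 / m) with weights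
   r and 1 - r gives r ln x <= ln m; one of the two u is nonzero. *)
have sum1 : r * (x / m) + (1 - r) * m^-1 = 1.
  by rewrite /m; field; rewrite -/m gt_eqF.
rewrite {1}/powR gt_eqF// -[ltRHS](lnK m0) ltr_expR.
have [lm0|lm0] := eqVneq (ln m) 0.
- have lx0 : ln x != 0 by rewrite ln_eq0.
  have := expR_gt1Dx lx0; rewrite lm0 subr0 in hx; rewrite -hx => hx'.
  rewrite lm0 oppr0 expR0 in h1; rewrite lm0.
  rewrite h1 in sum1; nra.
- have : - ln m != 0 by rewrite oppr_eq0.
  move=> /expR_gt1Dx; rewrite -h1 => h1'.
  have := expR_ge1Dx (ln x - ln m); rewrite -hx => hx'.
  nra.
Qed.

Variables (tau0 tau1 : R).
Hypotheses (htau0 : 0 < tau0) (htau1 : 0 < tau1).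
Local Notation s := (tau0 + tau1).
Local Notation th := (theta tau0 tau1).

(** The value of [Fobj] at [b], with [c] standing for [abar] and [Z] for [Zmass]. *)
Definition profile (c Z b : R) : R :=
  tau0 * c + tau1 * b - s * (b `^ (1 - th) * Z).

Lemma theta_gt0 : 0 < th.
Proof. by rewrite divr_gt0// addr_gt0. Qed.

Lemma onem_theta : 1 - th = tau1 / s.
Proof. by rewrite /theta; field; rewrite gt_eqF// addr_gt0. Qed.

Lemma onem_theta_itv : 0 < 1 - th < 1.
Proof.
rewrite onem_theta divr_gt0 ?addr_gt0//= ltr_pdivrMr ?addr_gt0//.
by rewrite mul1r ltrDr.
Qed.

(** Only the power of [b] is nonlinear. Its tangent at [z] strictly dominates it at [x] and [y], and
    the linear terms cancel in the weighted average. *)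
Lemma profile_strictly_convex (c Z x y t : R) : 0 < Z -> 0 < x -> 0 < y ->
  x != y -> 0 < t < 1 ->
  profile c Z (t * x + (1 - t) * y) <
    t * profile c Z x + (1 - t) * profile c Z y.
Proof.
move=> Z0 x0 y0 xy /andP[t0 t1].
have t1' : 0 < 1 - t by rewrite subr_gt0.
set z := t * x + (1 - t) * y; set r := 1 - th.
have z0 : 0 < z by rewrite addr_gt0// mulr_gt0.
(* By homogeneity, the tangent at [z] is the tangent at 1 evaluated at [u / z]. *)
have tangent u : 0 < u -> u != z ->
    u `^ r < z `^ r * (1 + r * (u / z - 1)).
  move=> u0 uz.
  rewrite -[X in X `^ _ < _](divfK (lt0r_neq0 z0)).
  rewrite powRM; [|exact/ltW/divr_gt0|exact: ltW].
  rewrite mulrC ltr_pM2l ?powR_gt0//.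
  apply: powR_lt_tangent; [exact: divr_gt0| |exact: onem_theta_itv].
  by apply: contra uz => /eqP uz1; rewrite -[u](divfK (lt0r_neq0 z0)) uz1 mul1r.
have hx : x != z.
  apply: contra xy; rewrite -subr_eq0 => /eqP xz; rewrite -subr_eq0.
  have : (1 - t) * (x - y) = 0 by rewrite -xz /z; ring.
  by move/eqP; rewrite mulf_eq0 gt_eqF.
have hy : y != z.
  apply: contra xy; rewrite -subr_eq0 => /eqP yz; rewrite -subr_eq0.
  have : t * (x - y) = 0 by rewrite -[RHS]oppr0 -yz /z; ring.
  by move/eqP; rewrite mulf_eq0 gt_eqF.
have key : t * x `^ r + (1 - t) * y `^ r < z `^ r.
  have -> : z `^ r = t * (z `^ r * (1 + r * (x / z - 1))) +
                     (1 - t) * (z `^ r * (1 + r * (y / z - 1))).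
    have e : t * (x / z - 1) + (1 - t) * (y / z - 1) = 0.
      transitivity ((t * x + (1 - t) * y) / z - 1); first by ring.
      by rewrite -/z divff ?subrr// gt_eqF.
    transitivity (z `^ r * (1 + r * (t * (x / z - 1) + (1 - t) * (y / z - 1)))).
      by rewrite e mulr0 addr0 mulr1.
    ring.
  by rewrite ltrD// ltr_pM2l// tangent.
have s0 : 0 < s by rewrite addr_gt0.
have : s * Z * (t * x `^ r + (1 - t) * y `^ r) < s * Z * z `^ r.
  by rewrite ltr_pM2l// mulr_gt0.
rewrite /profile -/r -subr_gt0 => h; rewrite -subr_gt0.
by congr (_ < _) : h; rewrite /z; ring.
Qed.

Lemma powR_thetaK (Z : R) : 0 < Z -> Z = (Z `^ (1 / th)) `^ th.
Proof.
move=> Z0; rewrite -powRrM mul1r mulVf ?(lt0r_neq0 theta_gt0)//.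
exact: esym (powRr1 (ltW Z0)).
Qed.

Lemma powR_onem_theta (B : R) : 0 < B -> B `^ (1 - th) * B `^ th = B.
Proof.
move=> B0; rewrite -powRD; last by rewrite (lt0r_neq0 B0) implybT.
by rewrite subrK powRr1// ltW.
Qed.

Lemma profile_min (c Z : R) : 0 < Z ->
  profile c Z (Z `^ (1 / th)) = tau0 * (c - Z `^ (1 / th)).
Proof.
move=> Z0; have B0 := powR_gt0 (1 / th) Z0; rewrite /profile.
rewrite {3}(powR_thetaK Z0); set B := Z `^ _ in B0 *.
by rewrite powR_onem_theta//; ring.
Qed.

Lemma profile_gt_min (c Z b : R) : 0 < Z -> 0 < b -> b != Z `^ (1 / th) ->
  tau0 * (c - Z `^ (1 / th)) < profile c Z b.
Proof.
move=> Z0 b0; have B0 := powR_gt0 (1 / th) Z0; rewrite /profile.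
(* Only the bare factor [Z] is rewritten as a power of the candidate. *)
rewrite {3}(powR_thetaK Z0); set B := Z `^ _ in B0 * => bB.
have bB0 : 0 < b / B by rewrite divr_gt0.
have bB1 : b / B != 1.
  by apply: contra bB => /eqP h; rewrite -[b](divfK (lt0r_neq0 B0)) h mul1r.
have := powR_lt_tangent bB0 bB1 onem_theta_itv.
have -> : b `^ (1 - th) * B `^ th = B * (b / B) `^ (1 - th).
  rewrite -{1}[b](divfK (lt0r_neq0 B0)); move: bB0; set v := b / B => v0.
  rewrite powRM; [|exact: ltW..].
  by rewrite -mulrA powR_onem_theta// mulrC.
set w := (b / B) `^ _ => hw.
have s0 : 0 < s by rewrite addr_gt0.
have : s * B * w < s * B * (1 + (1 - th) * (b / B - 1)).
  by rewrite ltr_pM2l// mulr_gt0.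
have -> : s * B * (1 + (1 - th) * (b / B - 1)) = tau0 * B + tau1 * b.
  by rewrite onem_theta; field; rewrite !gt_eqF.
lra.
Qed.

Lemma profile_argmin (c Z b : R) : 0 < Z -> 0 < b ->
  profile c Z b <= tau0 * (c - Z `^ (1 / th)) -> b = Z `^ (1 / th).
Proof.
move=> Z0 b0 h; apply/eqP/negPn/negP => /(profile_gt_min c Z0 b0).
by rewrite ltNge h.
Qed.

Lemma profile_ge_min (c Z b : R) : 0 < Z -> 0 < b ->
  tau0 * (c - Z `^ (1 / th)) <= profile c Z b.
Proof.
move=> Z0 b0; have [->|/profile_gt_min h] := eqVneq b (Z `^ (1 / th)).
  by rewrite profile_min.
exact/ltW/h.
Qed.

End scalar_profile.

(** * Closed form of the weighted objective *)

Section Fobj_formula.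
Context (R : realType) (d : nat) (tau0 tau1 : R) (n : nat).
Variables (lambda a : 'I_n -> R) (mu : 'I_n -> probability (Rd R d) R).
Hypotheses (htau0 : 0 < tau0) (htau1 : 0 < tau1) (hn : (1 <= n)%N).
Hypotheses (hlambda : forall i, 0 < lambda i)
  (hlambda1 : \sum_(i < n) lambda i = 1) (ha : forall i, 0 < a i).
Local Notation s := (tau0 + tau1).
Local Notation Z := (Zmass tau0 tau1 lambda a mu).
Implicit Types nu : probability (Rd R d) R.

(** Finiteness of [Aopt] turns the extended exponential into a real, positive one. *)
Lemma ZmassE nu : Z nu = \sum_(i < n) lambda i * a i `^ theta tau0 tau1 *
  expR (- (fine (Aopt tau0 tau1 (mu i) nu) / s)).
Proof.
apply: eq_bigr => i _; congr (_ * _).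
by rewrite -[in LHS](fineK (Aopt_fin_num htau0 htau1 (mu i) nu)).
Qed.

Lemma Zmass_gt0 nu : 0 < Z nu.
Proof.
have term_gt0 i : 0 < lambda i * a i `^ theta tau0 tau1 *
    expR (- (fine (Aopt tau0 tau1 (mu i) nu) / s)).
  by rewrite !mulr_gt0 ?powR_gt0 ?expR_gt0.
rewrite ZmassE (bigD1 (Ordinal hn))//= ltr_pwDl// sumr_ge0// => i _.
exact: ltW.
Qed.

Lemma FobjE nu (b : R) : 0 < b ->
  Fobj tau0 tau1 lambda a mu b nu =
  (profile tau0 tau1 (abar lambda a) (Z nu) b)%:E.
Proof.
move=> b0; rewrite /Fobj.
under eq_bigr do rewrite UOT_eq// -EFinM.
rewrite sumEFin; congr EFin; rewrite /profile ZmassE /abar.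
(* The weights sum to 1, so the [b] term can be spread over the sum. *)
rewrite [X in _ = _ + X - _](_ : _ = \sum_(i < n) tau1 * b * lambda i);
  last by rewrite -mulr_sumr hlambda1 mulr1.
rewrite !mulr_sumr -big_split -sumrB /=.
by apply: eq_bigr => i _; rewrite /optimal_mass; ring.
Qed.

End Fobj_formula.

(** * Minimizers in [b] alone and jointly in [b] and [nu] *)

Theorem theorem3p1 (R : realType) (d : nat) (tau0 tau1 : R) (n : nat)
    (lambda a : 'I_n -> R) (m : 'I_n -> Rd R d) (Sigma : 'I_n -> 'M[R]_d)
    (mu : 'I_n -> probability (Rd R d) R)
    (htau0 : 0 < tau0) (htau1 : 0 < tau1) (hn : (1 <= n)%N)
    (hlambda : forall i, 0 < lambda i) (hlambda1 : \sum_(i < n) lambda i = 1)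
    (ha : forall i, 0 < a i)
    (hSigma : forall i, spd (Sigma i))
    (hmu : forall i, is_gaussian (m i) (Sigma i) (mu i)) :
  let F := Fobj tau0 tau1 lambda a mu in
  let Z := Zmass tau0 tau1 lambda a mu in
  let th := theta tau0 tau1 in
  let G := @nondegenerate_gaussian R d in
  (forall nu, G nu ->
     [/\ strictly_convex_on [set b | 0 < b] (fun b => F b nu),
         argmin_on [set b | 0 < b] (fun b => F b nu) =
           [set Z nu `^ (1 / th)] &
         Phi tau0 tau1 lambda a mu nu =
           (tau0 * (abar lambda a - Z nu `^ (1 / th)))%:E])
  /\
  argmin_on [set bn : R * probability (Rd R d) R | 0 < bn.1 /\ G bn.2]
      (fun bn => F bn.1 bn.2) =
    [set (Z nu `^ (1 / th), nu) | nu in argmax_on G Z].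
Proof.
move=> F Z th G.
have FE nu (b : R) : 0 < b -> F b nu =
    (profile tau0 tau1 (abar lambda a) (Z nu) b)%:E.
  exact: FobjE.
have Z0 nu : 0 < Z nu by exact: Zmass_gt0.
(* Recorded before [F] becomes opaque, to keep [Phi] tied to it. *)
have PhiE nu : Phi tau0 tau1 lambda a mu nu =
    ereal_inf [set F b nu | b in [set b : R | 0 < b]] by [].
(* Otherwise failing unifications of [Z nu] with [Z nu'] unfold the infima. *)
clearbody F Z.
have B0 nu : 0 < Z nu `^ (1 / th) by exact: powR_gt0.
have FB nu : F (Z nu `^ (1 / th)) nu =
    (tau0 * (abar lambda a - Z nu `^ (1 / th)))%:E.
  by rewrite FE// profile_min.
have FB_le nu (b : R) : 0 < b -> (F (Z nu `^ (1 / th))%R nu <= F b nu)%E.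
  by move=> b0; rewrite FB FE// lee_fin profile_ge_min.
have FB_eq nu (b : R) : 0 < b -> (F b nu <= F (Z nu `^ (1 / th))%R nu)%E ->
    b = Z nu `^ (1 / th).
  by move=> b0; rewrite FB FE// lee_fin; exact: profile_argmin.
(* The profiled value decreases in [Z], which turns joint minimization into maximization of [Z]. *)
have FB_mono nu nu' : Z nu <= Z nu' ->
    (F (Z nu' `^ (1 / th))%R nu' <= F (Z nu `^ (1 / th))%R nu)%E.
  move=> ZZ; rewrite (FB nu) (FB nu') lee_fin ler_pM2l// lerD2l lerN2.
  by apply: ge0_ler_powR => //; rewrite ?nnegrE ltW// divr_gt0// theta_gt0.
split=> [nu _|].
  split.
  - move=> x y t x0 y0 xy t01; have /andP[t0 t1] := t01.
    rewrite !FE//; last by rewrite addr_gt0// mulr_gt0// subr_gt0.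
    rewrite -!EFinM -EFinD lte_fin; exact: profile_strictly_convex.
  - apply/seteqP; split=> [b [b0 bmin]|_ ->].
      by apply: FB_eq => //; exact: (bmin _ (B0 nu)).
    by split=> [|b b0]; [exact: B0|exact: FB_le].
  - rewrite PhiE -FB; apply/eqP; rewrite eq_le; apply/andP; split.
      by apply: ereal_inf_lbound; exists (Z nu `^ (1 / th)) => //; exact: B0.
    by apply: le_ereal_inf_tmp => _ [b b0 <-]; exact: FB_le.
apply/seteqP; split=> [[b nu] [[/= b0 Gnu] bmin]|_ [nu [Gnu Zmax] <-]].
- have bE : b = Z nu `^ (1 / th).
    by apply: FB_eq => //; exact: (bmin (_, nu) (conj (B0 nu) Gnu)).
  exists nu; last by rewrite -bE.
  (* A [nu'] with larger [Z] would have a strictly smaller profiled value. *)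
  split=> // nu' Gnu'; rewrite leNgt; apply/negP => ZZ.
  have := bmin (Z nu' `^ (1 / th), nu') (conj (B0 nu') Gnu').
  rewrite bE (FB nu) (FB nu') lee_fin ler_pM2l// lerD2l lerN2 leNgt.
  move=> /negP; apply.
  by apply: gt0_ltr_powR; rewrite ?nnegrE ?ltW// divr_gt0// theta_gt0.
- split; first exact: (conj (B0 nu) Gnu).
  move=> [b nu'] [/= b0 Gnu'].
  exact: (le_trans (FB_mono nu' nu (Zmax nu' Gnu')) (FB_le nu' b b0)).
Qed.
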